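(* Every reduced lobster in which all interior vertices $v$ of the central path (spine) satisfy $3\le\deg(v)\le 16$, except possibly for one interior vertex $v'$ with degree exceeding $16$, is neighborhood-prime.
   Context: All graphs are finite and simple; $[N]=\{1,\dots,N\}$; $N(v)$ is the set of neighbors of $v$. A neighborhood-prime labeling of a graph $G$ of order $N$ is a bijection $f:V(G)\to[N]$ such that for every vertex $v$ of degree greater than $1$, $\gcd\{f(u):u\in N(v)\}=1$; a graph is neighborhood-prime if it has such a labeling. A lobster is a tree containing a path, called the spine (or central path), such that every vertex is within distance $2$ of the spine. By convention the two end vertices of the spine are pendant vertices (degree $1$) of the lobster; the other spine vertices are the interior vertices of the spine. A reduced lobster is a lobster in which no non-spine pendant vertex is adjacent to the spine and every non-spine neighbor of a spine vertex has degree exactly $2$. *)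

(* Defs.v *)
From mathcomp Require Import all_boot.

Set Implicit Arguments.
Unset Strict Implicit.
Unset Printing Implicit Defensive.

(* Throughout, a finite simple graph is a finType [T] with an adjacency
   relation [e] that is symmetric and irreflexive. *)
Definition simple_graph (T : finType) (e : rel T) : Prop :=
  symmetric e /\ irreflexive e.

Definition nbhd (T : finType) (e : rel T) (v : T) : {set T} := [set u | e v u].

Definition deg (T : finType) (e : rel T) (v : T) : nat := #|nbhd e v|.

(* [ucycle e [:: u; v]] holds as soon as u and v are adjacent, so genuine
   cycles are those with at least 3 vertices. *)
Definition acyclic (T : finType) (e : rel T) : Prop :=
  forall c : seq T, ucycle e c -> size c < 3.

Definition is_tree (T : finType) (e : rel T) : Prop :=
  [/\ simple_graph e, 0 < #|T|, (forall u v : T, connect e u v) & acyclic e].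

Definition within_dist (T : finType) (e : rel T) (k : nat) (u v : T) : Prop :=
  exists p : seq T, [/\ path e u p, last u p = v & size p <= k].

(* A spine is given by its two end vertices [a], [b] and the sequence [m] of
   its interior vertices, in order. *)
Definition spine (T : finType) (a : T) (m : seq T) (b : T) : seq T :=
  a :: rcons m b.

Definition is_lobster (T : finType) (e : rel T) (a : T) (m : seq T) (b : T) :
    Prop :=
  [/\ is_tree e,
      path e a (rcons m b) /\ uniq (spine a m b),
      deg e a = 1 /\ deg e b = 1 &
      forall v : T, exists2 u, u \in spine a m b & within_dist e 2 u v].

Definition is_reduced_lobster (T : finType) (e : rel T)
    (a : T) (m : seq T) (b : T) : Prop :=
  [/\ is_lobster e a m b,
      (forall u w : T, u \in spine a m b -> w \notin spine a m b ->
         e u w -> deg e w <> 1) &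
      (forall u w : T, u \in spine a m b -> w \notin spine a m b ->
         e u w -> deg e w = 2)].

(* The ordinal [f u], in {0, ..., N-1}, encodes the label [f u + 1] in
   {1, ..., N}; 0 is the neutral element of [gcdn]. *)
Definition nbhd_prime_labeling (T : finType) (e : rel T) (f : T -> 'I_#|T|) :
    Prop :=
  bijective f /\
  forall v : T, 1 < deg e v -> \big[gcdn/0]_(u in nbhd e v) (f u).+1 = 1.

Definition nbhd_prime (T : finType) (e : rel T) : Prop :=
  exists f : T -> 'I_#|T|, nbhd_prime_labeling e f.

(* Main.v *)
Require Import Defs.
From mathcomp Require Import all_boot zify.

(** The proof cuts the vertex set into disjoint blocks, gives each block a run
    of consecutive labels, and uses Pillai's theorem: among at most 16
    consecutive integers, one is coprime to all the others
    ([coprime_to_rest]).  Giving that label to a distinguished vertex of the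
    block, its centre, makes the label of the centre coprime to every other
    label in the block.

    In a reduced lobster, every interior spine vertex c carries legs: middle
    vertices of degree 2, each followed by a leaf.  Fix one middle vertex,
    the hook of c, for each interior c, and let the hook of the end b be b
    itself.  For c among a and the interior vertices, the block of c consists
    of c, of the leaves of its legs, and of the hook of the vertex after c on
    the spine.  These blocks are pairwise disjoint ([block_disjoint]) and they
    settle every vertex of degree greater than 1 ([block_nbhd]):
    - a middle vertex on a leg of c has as neighbours c and a leaf of c, both
      in the block of c;
    - an interior vertex v, with predecessor p on the spine, has p and its own
      hook as neighbours, both in the block of p.
    The vertices outside the blocks are middle vertices other than the hooks;
    they may receive the remaining labels in any order.

    The block of an interior vertex c has at most deg c elements: two of its
    neighbours lie on the spine, which leaves deg c - 2 leaves.  So Pillai's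
    theorem applies to every vertex of degree at most 16, and the block of a
    single vertex of large degree is put first: its centre receives the
    label 1, which is coprime to everything ([coprime_block_order]).

    Disjointness of the blocks, and the fact that there are no vertices beyond
    the leaves, come from acyclicity: a path outside the spine joining two
    spine vertices would close a cycle with the spine ([ear_trivial]). *)

Set Implicit Arguments.
Unset Strict Implicit.
Unset Printing Implicit Defensive.

(** * Pillai's theorem for at most 16 consecutive integers *)

(** For integers n, ..., n + s - 1 with n congruent to r modulo p: the prime p
    divides n + x and also another of these integers, necessarily the one at
    distance p on one side or the other. *)
Definition clash (s p r x : nat) : bool :=
  (p %| r + x) && ((p <= x) || (x + p < s)).

(** Searches through the residues of n modulo the primes in [ps], one prime
    after another: whatever these residues are, some offset in [cand] clashes
    for none of the primes. *)
Fixpoint sieve_ok (s : nat) (ps cand : seq nat) : bool :=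
  if ps is p :: ps' then
    all (fun r => sieve_ok s ps' [seq x <- cand | ~~ clash s p r x]) (iota 0 p)
  else cand != [::].

(** Two distinct integers among 16 consecutive ones differ by at most 15, so
    these are their only possible common prime divisors. *)
Definition small_primes : seq nat := [:: 2; 3; 5; 7; 11; 13].

(** A finite computation, since only n modulo 30030 matters. A prime
    [p >= s] cannot clash, so leaving it out shortens the search. *)
Lemma sieve_ok_le16 :
  all (fun s => sieve_ok s [seq p <- small_primes | p < s] (iota 0 s))
      (iota 1 16).
Proof. by vm_compute. Qed.

Lemma sieve_okP (s n : nat) (ps cand : seq nat) :
    all [pred p | 0 < p] ps -> sieve_ok s ps cand ->
  exists2 x, x \in cand & forall p, p \in ps -> ~~ clash s p (n %% p) x.
Proof.
elim: ps cand => [|p ps IHps] cand /=.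
  by case: cand => // x cand _ _; exists x; rewrite ?mem_head.
case/andP=> p_gt0 ps_gt0 /allP/(_ (n %% p)).
rewrite mem_iota ltn_pmod // => /(_ isT) /(IHps _ ps_gt0)[x].
rewrite mem_filter => /andP[xNp cand_x] xNps; exists x => // q.
by rewrite inE => /predU1P[-> // | /xNps].
Qed.

Lemma mem_small_primes (p : nat) : prime p -> p < 16 -> p \in small_primes.
Proof. by do 16![case: p => [|p] //]. Qed.

(** The bound 16 is sharp: among the 17 integers from 2184 to 2200, none is
    coprime to all the others. *)
Lemma coprime_to_rest (n s : nat) : 0 < s <= 16 ->
  exists2 x, x < s &
    forall y, y < s -> y != x -> coprime (n + x) (n + y).
Proof.
move=> /andP[s_gt0 s_le16].
have s_in : s \in iota 1 16 by rewrite mem_iota; lia.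
have ps_gt0 : all [pred p | 0 < p] [seq p <- small_primes | p < s].
  by apply/allP=> p; rewrite mem_filter => /andP[_]; rewrite !inE /=; lia.
have [x] := sieve_okP n ps_gt0 (allP sieve_ok_le16 s s_in).
rewrite mem_iota => x_lt_s xN; exists x => [|y y_lt_s yx]; first by lia.
apply/negPn/negP=> Ncop.
have gcd_gt0 : 0 < gcdn (n + x) (n + y) by rewrite gcdn_gt0; lia.
have gcd_gt1 : 1 < gcdn (n + x) (n + y) by move: Ncop; rewrite /coprime; lia.
have p_pr := pdiv_prime gcd_gt1; have := pdiv_dvd (gcdn (n + x) (n + y)).
move: (pdiv _) p_pr => p p_pr; rewrite dvdn_gcd => /andP[px py].
have dvd_diff u v : p %| n + u -> p %| n + v -> v < u -> v + p <= u.
  move=> pu pv vu; have: p %| u - v by rewrite -(subnDl n) dvdn_sub.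
  by move/dvdn_leq; lia.
have near : (p <= x) || (x + p < s).
  have [xy|yx'|eq_xy] := ltngtP x y; last by rewrite eq_xy eqxx in yx.
    by have := dvd_diff _ _ py px xy; lia.
  by have := dvd_diff _ _ px py yx'; lia.
have p_lt_s : p < s by lia.
have /xN/negP[] : p \in [seq p <- small_primes | p < s].
  by rewrite mem_filter p_lt_s mem_small_primes //; lia.
by rewrite /clash near andbT /dvdn modnDml.
Qed.

(** * Labelling block by block *)

(** The position of a vertex in the list, plus one, is to be its label. The
    block of [c0] heads the list with [c0] in front, so that [c0] gets the
    label 1 and the size of its block is unrestricted; each other block is
    appended with its centre moved to the offset given by Pillai's theorem. *)
Lemma coprime_block_order (T : finType) (B : T -> {set T}) (c0 : T)
    (cs : seq T) :
    {in c0 :: cs, forall c, c \in B c} ->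
    {in c0 :: cs &, forall c d x, x \in B c -> x \in B d -> c = d} ->
    uniq (c0 :: cs) -> {in cs, forall c, #|B c| <= 16} ->
  exists L : seq T,
    [/\ uniq L, L =i [pred x | has (fun c => x \in B c) (c0 :: cs)] &
       {in c0 :: cs, forall c x, x \in B c -> x != c ->
          coprime (index c L).+1 (index x L).+1}].
Proof.
elim: cs => [|c cs IHcs] Bself Bdisj cs_uniq Bsmall.
  exists (c0 :: enum (B c0 :\ c0)); split.
  - by rewrite /= mem_enum setD11 enum_uniq.
  - move=> x; rewrite in_cons mem_enum in_setD1 [RHS]inE /= orbF.
    by case: eqP => [->|] //=; rewrite Bself ?mem_head.
  - by move=> c; rewrite inE => /eqP-> x _ _; rewrite /= eqxx coprime1n.
have sub_cs : {subset c0 :: cs <= [:: c0, c & cs]}.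
  by move=> x; rewrite !inE => /orP[]->; rewrite ?orbT.
have c_in : c \in [:: c0, c & cs] by rewrite !inE eqxx orbT.
have cN : c \notin c0 :: cs.
  by case/and3P: cs_uniq; rewrite !inE !negb_or eq_sym => /andP[-> _] -> _.
have [||||L [L_uniq memL L_cop]] := IHcs.
- by move=> x /sub_cs/Bself.
- by move=> x y /sub_cs x_in /sub_cs; apply: Bdisj.
- by move: cs_uniq; rewrite /= inE negb_or -!andbA => /and4P[_ -> _ ->].
- by move=> x x_cs; apply: Bsmall; rewrite inE x_cs orbT.
have c_B := Bself c c_in.
have B_L x : x \in B c -> x \notin L.
  move=> xc; rewrite memL; apply/negP=> /hasP[d d_cs xd].
  by move: cN; rewrite (Bdisj c d c_in (sub_cs _ d_cs) x xc xd) d_cs.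
have [|i i_lt i_cop] := @coprime_to_rest (size L).+1 #|B c|.
  by rewrite Bsmall ?mem_head // andbT card_gt0; apply/set0Pn; exists c.
have others_size : size (enum (B c :\ c)) = #|B c|.-1.
  by rewrite -cardE (cardsD1 c (B c)) c_B.
pose o := enum (B c :\ c).
(* The new block, in arbitrary order but with [c] at offset [i]. *)
pose M := take i o ++ c :: drop i o.
have M_perm : perm_eq M (c :: o).
  by rewrite /M -cat1s perm_catCA cat1s perm_cons cat_take_drop.
have o_uniq : uniq (c :: o) by rewrite /= mem_enum setD11 enum_uniq.
have M_uniq : uniq M by rewrite (perm_uniq M_perm).
have memM : M =i B c.
  move=> x; rewrite (perm_mem M_perm) inE mem_enum !inE.
  by case: eqP => [->|].
have M_size : size M = #|B c|.
  by rewrite (perm_size M_perm) /= others_size prednK // (leq_trans _ i_lt).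
have idx_c : index c M = i.
  rewrite /M index_cat ifN /= ?eqxx ?addn0 ?size_takel ?others_size //.
    by move: i_lt; lia.
  by apply/negP=> /mem_take; rewrite mem_enum setD11.
exists (L ++ M); split.
- rewrite cat_uniq L_uniq M_uniq andbT; apply/hasPn=> x /=.
  by rewrite memM; apply: B_L.
- by move=> x; rewrite mem_cat memL memM [RHS]inE inE /= -orbA (orbC (has _ _)).
move=> d d_in x xd x_d; rewrite !(index_cat _ L M).
have [d_cs|dN] := boolP (d \in c0 :: cs).
  have [dL xL] : d \in L /\ x \in L.
    by rewrite !memL; split; apply/hasP; exists d => //; apply: Bself.
  by rewrite dL xL L_cop.
have dc : d = c.
  apply/eqP; move: d_in dN; rewrite !inE.
  by case: (d == c0) (d == c) (d \in cs) => [] [] [].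
rewrite dc in xd x_d *.
rewrite (negPf (B_L c c_B)) (negPf (B_L x xd)) idx_c -!addSn; apply: i_cop.
  by rewrite -M_size index_mem memM.
apply: contra_neq x_d => eq_i.
by apply: (@index_inj _ c M); rewrite ?memM ?idx_c.
Qed.

(** Two neighbours of [v] with coprime labels already force the gcd over the
    whole neighbourhood to be 1. *)
Lemma nbhd_prime_of_blocks (T : finType) (e : rel T) (B : T -> {set T})
    (c0 : T) (cs : seq T) :
    {in c0 :: cs, forall c, c \in B c} ->
    {in c0 :: cs &, forall c d x, x \in B c -> x \in B d -> c = d} ->
    uniq (c0 :: cs) -> {in cs, forall c, #|B c| <= 16} ->
    (forall v, 1 < deg e v -> exists c x,
       [/\ c \in c0 :: cs, x \in B c, x != c, e v c & e v x]) ->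
  nbhd_prime e.
Proof.
move=> Bself Bdisj cs_uniq Bsmall Bnbhd.
have [L [L_uniq memL L_cop]] := coprime_block_order Bself Bdisj cs_uniq Bsmall.
(* The vertices outside the blocks take the remaining labels. *)
pose F := L ++ [seq x <- enum T | x \notin L].
have memF x : x \in F by rewrite mem_cat mem_filter mem_enum andbT orbN.
have F_uniq : uniq F.
  rewrite cat_uniq L_uniq filter_uniq ?enum_uniq // andbT.
  by apply/hasPn=> x; rewrite mem_filter => /andP[].
have F_size : size F = #|T|.
  by rewrite -(card_uniqP F_uniq); apply: eq_card => x; rewrite memF.
have lt_idx x : index x F < #|T| by rewrite -F_size index_mem.
pose f x := Ordinal (lt_idx x).
exists f; split.
  apply: inj_card_bij; last by rewrite card_ord.
  by move=> x y [] /index_inj; apply.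
move=> v /Bnbhd[c [x [c_cs xc x_c vc vx]]].
have [cL xL] : c \in L /\ x \in L.
  by rewrite !memL; split; apply/hasP; exists c => //; apply: Bself.
have := L_cop c c_cs x xc x_c; rewrite /coprime => /eqP cop.
apply/eqP; rewrite -dvdn1 -cop dvdn_gcd; apply/andP; split.
  by apply: (biggcdn_inf c); rewrite ?inE //= /F index_cat cL.
by apply: (biggcdn_inf x); rewrite ?inE //= /F index_cat xL.
Qed.

(** * Ears of a path in an acyclic graph *)

(** Following the path from [u] to [v] and coming back through [q] is a cycle
    with [size p2 + size q + 2] vertices. An empty [q] stands for a chord. *)
Lemma ear_closes_cycle (T : finType) (e : rel T) (p1 p2 p3 q : seq T)
    (u v : T) :
    symmetric e -> acyclic e ->
    sorted e (p1 ++ u :: p2 ++ v :: p3) -> uniq (p1 ++ u :: p2 ++ v :: p3) ->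
    path e u (rcons q v) -> uniq q ->
    {in q, forall x, x \notin p1 ++ u :: p2 ++ v :: p3} ->
  p2 = [::] /\ q = [::].
Proof.
move=> e_sym acyc s_path s_uniq q_path q_uniq qN.
have [p2_path e_v] : path e u p2 /\ e (last u p2) v.
  have : path e u (p2 ++ v :: p3).
    by case: p1 s_path {s_uniq qN} => [|x p1] //=; rewrite cat_path => /and3P[].
  by rewrite cat_path /= => /and3P[].
have rev_q_path : path e v (rcons (rev q) u).
  rewrite -rev_cons -(belast_rcons u q v) -{1}(last_rcons u q v) rev_path.
  by rewrite (@eq_path _ _ e) // => x y; rewrite e_sym.
have c_uniq : uniq (u :: p2 ++ v :: rev q).
  have cat_s : u :: p2 ++ v :: rev q = rcons (u :: p2) v ++ rev q.
    by rewrite cat_rcons.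
  rewrite cat_s cat_uniq rev_uniq q_uniq andbT; apply/andP; split.
    move: s_uniq; rewrite cat_uniq => /and3P[_ _].
    by rewrite -cat_cons -cat_rcons cat_uniq => /andP[].
  apply/hasPn=> x; rewrite mem_rev => /qN; apply: contra.
  rewrite mem_rcons inE /= inE mem_cat inE mem_cat inE.
  by case/or3P=> ->; rewrite ?orbT.
have /acyc : ucycle e (u :: p2 ++ v :: rev q).
  apply/andP; split=> //=.
  by rewrite rcons_cat cat_path /= p2_path e_v rev_q_path.
by rewrite /= size_cat /= size_rev => size_lt; split; apply: size0nil; lia.
Qed.

(** The case [u = v] remains for an ear of one vertex, because walking along an
    edge and back is not a cycle. *)
Lemma ear_trivial (T : finType) (e : rel T) (s q : seq T) (u v : T) :
    symmetric e -> acyclic e -> sorted e s -> uniq s ->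
    u \in s -> v \in s ->
    path e u (rcons q v) -> uniq q -> {in q, forall x, x \notin s} ->
    0 < size q ->
  u = v /\ size q = 1.
Proof.
move=> e_sym acyc s_path s_uniq us vs q_path q_uniq qN q_gt0.
have [uv|u_v] := eqVneq u v.
  split=> //; have /acyc /= : ucycle e (u :: q).
    rewrite /ucycle /= q_uniq andbT {2}uv q_path /=.
    by apply/negP=> /qN; rewrite us.
  by lia.
suff q0 : q = [::] by rewrite q0 in q_gt0.
have [p1 [p2 s_def]] : exists p1 p2, s = p1 ++ u :: p2.
  by case/splitPr: us => p1 p2; exists p1, p2.
subst s; move: vs; rewrite mem_cat inE eq_sym (negPf u_v) /=.
case/orP=> /path.splitPr v_in.
  case: v_in s_path s_uniq qN {us} => p3 p4; rewrite -catA /=.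
  move=> s_path s_uniq qN.
  suff [_ q0] : p4 = [::] /\ rev q = [::].
    by rewrite -(revK q) q0.
  apply: (ear_closes_cycle e_sym acyc s_path s_uniq).
  - rewrite -rev_cons -(belast_rcons u q v) -{1}(last_rcons u q v) rev_path.
    by rewrite (@eq_path _ _ e) // => x y; rewrite e_sym.
  - by rewrite rev_uniq.
  - by move=> x; rewrite mem_rev => /qN.
case: v_in s_path s_uniq qN {us} => p3 p4 s_path s_uniq qN.
by have [_ ->] := ear_closes_cycle e_sym acyc s_path s_uniq q_path q_uniq qN.
Qed.

(** * The structure of a reduced lobster *)

Section ReducedLobster.

Variables (T : finType) (e : rel T) (a : T) (m : seq T) (b : T).
Hypothesis hL : is_reduced_lobster e a m b.

Local Notation s := (spine a m b).

Let e_sym : symmetric e.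
Proof. by case: hL => [[[[]]]]. Qed.

Let e_irr : irreflexive e.
Proof. by case: hL => [[[[]]]]. Qed.

Let s_uniq : uniq s.
Proof. by case: hL => [[_ []]]. Qed.

Let s_path : path e a (rcons m b).
Proof. by case: hL => [[_ []]]. Qed.

Lemma spine_ear_trivial (q : seq T) (u v : T) : u \in s -> v \in s ->
    path e u (rcons q v) -> uniq q -> {in q, forall x, x \notin s} ->
    0 < size q ->
  u = v /\ size q = 1.
Proof. by case: hL => [[[_ _ _ acyc]] _ _ _] _ _; apply: ear_trivial. Qed.

Definition legs (u : T) : {set T} := nbhd e u :\: [set x in s].
(** The far end of the leg of [u] through [w]. The default value [w] is never
    taken, since [w] has degree 2. *)
Definition tip (u w : T) : T := odflt w [pick x in nbhd e w :\ u].
Definition leaves (u : T) : {set T} := [set tip u w | w in legs u].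
Definition succ (c : T) : T := nth b s (index c s).+1.
(** The default value [u] serves for [u = b], which has no legs: then the last
    block ends with [b], and all blocks have the same shape. *)
Definition hook (u : T) : T := odflt u [pick w in legs u].
Definition block (c : T) : {set T} := c |: (hook (succ c) |: leaves c).

Lemma in_legs (u w : T) : (w \in legs u) = (w \notin s) && e u w.
Proof. by rewrite !inE. Qed.

Lemma nbhd_leg (u w : T) : u \in s -> w \in legs u ->
  nbhd e w = [set u; tip u w] /\ tip u w != u.
Proof.
move=> us; rewrite in_legs => /andP[wN uw].
have w_deg : #|nbhd e w| = 2 by case: hL => _ _ /(_ u w us wN uw).
have u_w : u \in nbhd e w by rewrite inE e_sym.
have /cards1P[x x_def] : #|nbhd e w :\ u| == 1.
  by move: w_deg; rewrite (cardsD1 u) u_w add1n => -[->].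
have tip_x : tip u w = x.
  rewrite /tip; case: pickP => [y | /(_ x)]; rewrite x_def inE ?eqxx //.
  by move/eqP.
rewrite tip_x -x_def setD1K //; split=> //.
by have : x \in nbhd e w :\ u; [rewrite x_def set11 | case/setD1P].
Qed.

Lemma leg_tip (u w : T) : u \in s -> w \in legs u -> e w (tip u w).
Proof.
move=> us wu; have : tip u w \in nbhd e w.
  by have [-> _] := nbhd_leg us wu; rewrite !inE eqxx orbT.
by rewrite inE.
Qed.

(** Otherwise [w] would be an ear with two distinct ends. *)
Lemma leg_inj (u v w : T) : u \in s -> v \in s ->
  w \in legs u -> w \in legs v -> u = v.
Proof.
move=> us vs; rewrite !in_legs => /andP[wN uw] /andP[_ vw].
have [] // := @spine_ear_trivial [:: w] u v us vs.
  by rewrite /= uw e_sym vw.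
by move=> x; rewrite inE => /eqP->.
Qed.

Lemma tip_notin_spine (u w : T) : u \in s -> w \in legs u -> tip u w \notin s.
Proof.
move=> us wu; apply/negP=> ts; have [_ /eqP[]] := nbhd_leg us wu.
apply: (leg_inj ts us (w := w)) => //.
rewrite in_legs e_sym (leg_tip us wu) andbT.
by move: wu; rewrite in_legs => /andP[].
Qed.

(** Otherwise [w] and its tip would form an ear with two vertices. *)
Lemma spine_tip_far (u v w : T) : u \in s -> v \in s -> w \in legs u ->
  ~~ e v (tip u w).
Proof.
move=> us vs wu; apply/negP=> vt; have wt := leg_tip us wu.
have tN := tip_notin_spine us wu; move: (wu); rewrite in_legs => /andP[wN uw].
have [] // := @spine_ear_trivial [:: w; tip u w] u v us vs.
- by rewrite /= uw wt e_sym vt.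
- by rewrite /= inE andbT; apply: contraTneq wt => <-; rewrite e_irr.
- by move=> x; rewrite !inE => /orP[]/eqP->.
Qed.

(** Otherwise [w], its tip and [w'] would form an ear with three vertices. *)
Lemma leg_of_tip_inj (u v w w' : T) : u \in s -> v \in s ->
  w \in legs u -> w' \in legs v -> e w' (tip u w) -> w = w'.
Proof.
move=> us vs wu w'v w't; have wt := leg_tip us wu.
have tN := tip_notin_spine us wu; move: (wu) w'v.
rewrite !in_legs => /andP[wN uw] /andP[w'N vw'].
apply/eqP/negPn/negP=> w_w'.
have [] // := @spine_ear_trivial [:: w; tip u w; w'] u v us vs.
- by rewrite /= uw wt (e_sym _ w') w't e_sym vw'.
- rewrite /= !inE negb_or w_w' !andbT; apply/andP; split.
    by apply: contraTneq wt => <-; rewrite e_irr.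
  by apply: contraTneq w't => ->; rewrite e_irr.
- by move=> x; rewrite !inE => /or3P[]/eqP->.
Qed.

(** A second neighbour [z] of the tip would be within distance 2 of the spine,
    and a shortest way back from [z] to the spine would complete an ear with
    two, three or four vertices. This is what bounds the legs: the definition fixes
    the degree of [w] but leaves that of the tip open. *)
Lemma deg_tip (u w : T) : u \in s -> w \in legs u -> deg e (tip u w) <= 1.
Proof.
move=> us wu; rewrite /deg -(cards1 w); apply/subset_leq_card/subsetP=> z.
rewrite !inE => tz; apply/eqP.
(* Let [z] be a neighbour of the tip, to be identified with [w]. *)
have tN := tip_notin_spine us wu; have wt := leg_tip us wu.
have zN : z \notin s.
  by apply: contraL tz => zs; rewrite e_sym spine_tip_far.
have [_ _ _ /(_ z)[v vs [p [p_path p_last p_size]]]] : is_lobster e a m b.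
  by case: hL.
have z_legs (x : T) : x \in s -> e x z -> z = w.
  move=> xs xz; apply/esym/(leg_of_tip_inj us xs wu); last by rewrite e_sym.
  by rewrite in_legs zN.
case: p p_path p_last p_size => [_ vz|y [|y' [|? ?]]] //=.
- by rewrite -vz vs in zN.
- by rewrite andbT => vy yz _; apply: (z_legs v) => //; rewrite -yz.
case/and3P=> vy yy' _ y'z _; rewrite {y'}y'z in yy'.
have [ys|yN] := boolP (y \in s); first exact: (z_legs y).
apply/eqP/negPn/negP=> z_w; move: (wu); rewrite in_legs => /andP[wN uw].
have y_v : y \in legs v by rewrite in_legs yN.
have [y_w|y_w] := eqVneq y w.
  have : z \in nbhd e w by rewrite inE -y_w.
  have [-> _] := nbhd_leg us wu; rewrite !inE => /orP[]/eqP zE.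
    by rewrite zE us in zN.
  by rewrite zE e_irr in tz.
have [] // := @spine_ear_trivial [:: w; tip u w; z; y] u v us vs.
- by rewrite /= uw wt tz (e_sym z) yy' e_sym vy.
- rewrite /= !inE !negb_or (eq_sym w z) z_w (eq_sym w y) y_w !andbT /=.
  apply/and3P; split; last by apply: contraTneq yy' => ->; rewrite e_irr.
    by apply: contraTneq wt => <-; rewrite e_irr.
  rewrite -negb_or; apply/norP; split; apply/eqP=> tE.
    by rewrite tE e_irr in tz.
  by have := spine_tip_far us vs wu; rewrite tE vy.
- by move=> x; rewrite !inE => /or4P[]/eqP->.
Qed.

Lemma vertex_cases (x : T) :
  [\/ x \in s, exists2 u, u \in s & x \in legs u | deg e x <= 1].
Proof.
have [xs|xN] := boolP (x \in s); first by constructor 1.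
have [_ _ _ /(_ x)[v vs [p [p_path p_last p_size]]]] : is_lobster e a m b.
  by case: hL.
case: p p_path p_last p_size => [_ vx|y [|y' [|? ?]]] //=.
- by rewrite -vx vs in xN.
- rewrite andbT => vy yx _; constructor 2; exists v => //.
  by rewrite in_legs xN -yx.
case/and3P=> vy yy' _ y'x _; rewrite {y'}y'x in yy'.
have [ys|yN] := boolP (y \in s).
  by constructor 2; exists y; rewrite // in_legs xN.
have y_v : y \in legs v by rewrite in_legs yN.
have : x \in nbhd e y by rewrite inE.
have [-> _] := nbhd_leg vs y_v; rewrite !inE => /orP[]/eqP xE.
  by rewrite xE vs in xN.
by constructor 3; rewrite xE deg_tip.
Qed.

Lemma in_spine (x : T) : (x \in s) = (x \in a :: m) || (x == b).
Proof. by rewrite inE mem_rcons !inE orbA orbAC. Qed.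

Lemma b_notin_init : b \notin a :: m.
Proof.
have := s_uniq; rewrite /spine -rcons_cons rcons_uniq.
by case/andP.
Qed.

(** Only [b] has the last index, so a vertex of [a :: m] has a successor. *)
Lemma index_init (c : T) : c \in a :: m -> index c s < (size m).+1.
Proof.
by move=> c_in; rewrite /spine -rcons_cons -cats1 index_cat c_in index_mem.
Qed.

Lemma size_spine : size s = (size m).+2.
Proof. by rewrite /= size_rcons. Qed.

Lemma succ_spine (c : T) : succ c \in s.
Proof.
rewrite /succ; have [lt_s|ge_s] := ltnP (index c s).+1 (size s).
  exact: mem_nth.
by rewrite nth_default // in_spine eqxx orbT.
Qed.

Lemma edge_succ (c : T) : c \in a :: m -> e c (succ c).
Proof.
move=> c_in; have cs : c \in s by rewrite in_spine c_in.
have /(pathP b)/(_ (index c s)) := s_path.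
by rewrite size_rcons index_init // nth_index // => /(_ isT).
Qed.

Lemma index_succ (c : T) : c \in a :: m -> index (succ c) s = (index c s).+1.
Proof.
by move=> c_in; rewrite /succ index_uniq // size_spine ltnS index_init.
Qed.

Lemma succ_inj : {in a :: m &, injective succ}.
Proof.
move=> c d c_in d_in succ_eq.
have := index_succ c_in; rewrite succ_eq index_succ // => -[/esym].
by apply: (@index_inj _ a s);
  rewrite in_spine ?c_in ?d_in.
Qed.

Lemma succ_onto (c : T) : c \in m -> exists2 p, p \in a :: m & succ p = c.
Proof.
move=> c_m; have /(nthP b)[i i_lt <-] := c_m.
have i_in : nth b (a :: m) i \in a :: m by rewrite mem_nth //= ltnW.
exists (nth b (a :: m) i); rewrite // /succ.
have -> : nth b (a :: m) i = nth b s i.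
  by rewrite /spine -rcons_cons nth_rcons /= ltnS ltnW.
rewrite index_uniq ?size_spine //; last by do 2!apply: ltnW.
by rewrite /= nth_rcons i_lt.
Qed.

Lemma legs_end (x y : T) : y \in s -> e x y -> deg e x = 1 -> legs x = set0.
Proof.
move=> ys xy /eqP/cards1P[z z_def]; apply/setP=> w.
rewrite in_legs in_set0; apply/negbTE/negP=> /andP[wN xw].
have : w \in nbhd e x by rewrite inE.
have : y \in nbhd e x by rewrite inE.
by rewrite z_def !inE => /eqP<- /eqP w_y; rewrite w_y ys in wN.
Qed.

Lemma legs_a : legs a = set0.
Proof.
apply: (legs_end (succ_spine a)); first by rewrite edge_succ ?mem_head.
by case: hL => [[_ _ []]].
Qed.

Lemma legs_b : legs b = set0.
Proof.
pose c := last a m; have c_in : c \in a :: m by rewrite mem_last.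
apply: (legs_end (y := c)); first by rewrite in_spine c_in.
  by have := s_path; rewrite rcons_path e_sym => /andP[].
by case: hL => [[_ _ []]].
Qed.

(** A chord of the spine would be an ear without vertices, closing a cycle with
    the part of the spine that it shortcuts. *)
Lemma spine_chord (u v : T) : u \in s -> v \in s -> e u v ->
  index u s < index v s -> v = succ u.
Proof.
move=> us vs uv lt_uv.
have acyc : acyclic e by case: hL => [[[_ _ _ ?]]].
have {vs} v_drop : v \in drop (index u s).+1 s.
  have := vs; rewrite -{1}(cat_take_drop (index u s).+1 s) mem_cat.
  by rewrite in_take // ltnS leqNgt lt_uv.
have s_def : s = take (index u s) s ++ u :: drop (index u s).+1 s.
  by rewrite -drop_index // cat_take_drop.
have drop_succ : head b (drop (index u s).+1 s) = succ u.
  by rewrite -nth0 nth_drop addn0.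
move: v_drop s_def drop_succ; case/splitPr=> p2 p3 s_def.
have [] := @ear_closes_cycle T e (take (index u s) s) p2 p3 [::] u v e_sym acyc.
- by rewrite -s_def.
- by rewrite -s_def.
- by rewrite /= uv.
- by [].
- by [].
by move=> ->.
Qed.

(** The neighbours of an interior vertex on the spine are exactly its
    predecessor and its successor. The bound from above on the number of legs
    controls the size of the blocks; the one from below provides hooks. *)
Lemma card_legs (c : T) : c \in m -> (#|legs c| + 2)%N = deg e c.
Proof.
move=> c_m; have c_in : c \in a :: m by rewrite inE c_m orbT.
have cs : c \in s by rewrite in_spine c_in.
have [p p_in pc] := succ_onto c_m.
have p_sc : p != succ c.
  apply/eqP=> p_def; have := index_succ p_in.
  by rewrite pc p_def index_succ //; lia.
have ps : p \in s by rewrite in_spine p_in.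
rewrite /deg -(cardsID [set x in s] (nbhd e c)) addnC; congr (_ + _)%N.
rewrite -[LHS]/(true.+1) -p_sc -cards2; congr #|pred_of_set _|.
apply/setP=> x; rewrite in_set2 in_setI /nbhd !in_set.
apply/orP/andP=> [[/eqP->|/eqP->]|[cx xs]].
- by rewrite ps e_sym -{1}pc edge_succ.
- by rewrite edge_succ ?succ_spine.
have [lt_xc|lt_cx|eq_xc] := ltngtP (index x s) (index c s).
- left; apply/eqP/succ_inj=> //.
    2: by rewrite pc (spine_chord xs cs) // e_sym.
  rewrite in_spine in xs; case/orP: xs lt_xc => // /eqP->.
  have := index_init c_in.
  have -> : index b s = (size m).+1; last by lia.
  rewrite /spine -rcons_cons -cats1 index_cat (negPf b_notin_init).
  by rewrite /= eqxx addn0.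
- by right; rewrite (spine_chord cs xs).
- by move: cx; rewrite (@index_inj _ a s _ _ xs cs eq_xc) e_irr.
Qed.

(** * The blocks *)

Section Blocks.

Hypothesis deg_ge3 : forall c : T, c \in m -> 3 <= deg e c.

Lemma hook_leg (c : T) : c \in m -> hook c \in legs c.
Proof.
move=> c_m; rewrite /hook; case: pickP => //= legs0.
have := deg_ge3 c_m; rewrite -card_legs //.
by rewrite (eq_card0 (A := legs c)) // => x; apply: legs0.
Qed.

Lemma hook_b : hook b = b.
Proof.
by rewrite /hook; case: pickP => //= x; rewrite legs_b inE.
Qed.

Lemma succ_cases (c : T) : c \in a :: m -> succ c = b \/ succ c \in m.
Proof.
move=> c_in; have := succ_spine c; rewrite in_spine inE.
case/orP=> [/orP[/eqP sc_a|]|/eqP]; [|by right|by left].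
by have := index_succ c_in; rewrite sc_a /= eqxx.
Qed.

Lemma hook_succ_notin (c : T) : c \in a :: m -> hook (succ c) \notin a :: m.
Proof.
case/succ_cases=> [->|/hook_leg]; first by rewrite hook_b b_notin_init.
by rewrite in_legs in_spine negb_or -andbA => /and3P[].
Qed.

Lemma hook_succ_inj : {in a :: m &, injective (hook \o succ)}.
Proof.
move=> c d c_in d_in /= hook_eq; apply: succ_inj => //.
have b_no_leg v : v \in m -> hook v <> b.
  move=> v_m hook_v; have := hook_leg v_m.
  by rewrite hook_v in_legs in_spine eqxx orbT.
have [c_b|c_m] := succ_cases c_in; have [d_b|d_m] := succ_cases d_in.
- by rewrite c_b.
- by case: (b_no_leg _ d_m); rewrite -hook_eq c_b hook_b.
- by case: (b_no_leg _ c_m); rewrite hook_eq d_b hook_b.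
apply: (leg_inj (succ_spine c) (succ_spine d) (hook_leg c_m)).
by rewrite hook_eq hook_leg.
Qed.

Lemma leaf_notin_spine (c x : T) : c \in s -> x \in leaves c -> x \notin s.
Proof. by move=> cs /imsetP[w wc ->]; apply: tip_notin_spine. Qed.

Lemma leaf_not_hook (c d : T) : c \in s -> d \in a :: m ->
  hook (succ d) \notin leaves c.
Proof.
move=> cs d_in; apply/negP; have [->|sd_m] := succ_cases d_in.
  by rewrite hook_b => /(leaf_notin_spine cs); rewrite in_spine eqxx orbT.
case/imsetP=> w wc hook_tip; have := hook_leg sd_m.
by rewrite hook_tip in_legs (negPf (spine_tip_far _ _ _)) ?succ_spine ?andbF.
Qed.

Lemma leaf_inj (c d x : T) : c \in s -> d \in s ->
  x \in leaves c -> x \in leaves d -> c = d.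
Proof.
move=> cs ds /imsetP[w wc ->] /imsetP[w' w'd tip_eq].
have ww' : w = w'.
  by apply: (leg_of_tip_inj cs ds wc w'd); rewrite tip_eq leg_tip.
by apply: (leg_inj cs ds wc); rewrite ww'.
Qed.

(** A block contains three kinds of vertices: one in [a :: m], a hook, and
    leaves. No vertex is of two kinds, and each kind determines the centre. *)
Lemma block_disjoint : {in a :: m &, forall c d x : T,
  x \in block c -> x \in block d -> c = d}.
Proof.
move=> c d c_in d_in x.
have cs : c \in s by rewrite in_spine c_in.
have ds : d \in s by rewrite in_spine d_in.
rewrite !in_setU1 => /or3P[/eqP->|/eqP->|xc] /or3P[/eqP|/eqP|].
- by [].
- by move=> c_hook; have := hook_succ_notin d_in; rewrite -c_hook c_in.
- by move/(leaf_notin_spine ds); rewrite cs.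
- by move=> hook_d; have := hook_succ_notin c_in; rewrite hook_d d_in.
- exact: hook_succ_inj.
- by rewrite (negPf (leaf_not_hook ds c_in)).
- by move=> xd; have := leaf_notin_spine cs xc; rewrite xd ds.
- by move=> x_hook; have := leaf_not_hook cs d_in; rewrite -x_hook xc.
- exact: leaf_inj.
Qed.

(** For an interior vertex the right-hand side is its degree, by
    [card_legs]. *)
Lemma card_block (c : T) : #|block c| <= #|legs c| + 2.
Proof.
rewrite addn2 /block cardsU1 -(add1n #|_|.+1); apply: leq_add (leq_b1 _) _.
rewrite cardsU1 -(add1n #|_|); apply: leq_add (leq_b1 _) _.
exact: leq_imset_card.
Qed.

(** The hook of the block of [p] settles the spine vertex after [p], and the
    leaves in the block of [u] settle the middle vertices next to [u]. *)
Lemma block_nbhd (v : T) : 1 < deg e v ->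
  exists c x, [/\ c \in a :: m, x \in block c, x != c, e v c & e v x].
Proof.
move=> v_deg; have [deg_a deg_b] : deg e a = 1 /\ deg e b = 1.
  by case: hL => [[_ _ []]].
have [v_s | [u us v_leg] | ] := vertex_cases v; last by rewrite leqNgt v_deg.
- have v_m : v \in m.
    move: v_s; rewrite in_spine inE => /orP[/orP[/eqP v_a|//]|/eqP v_b].
      by rewrite v_a deg_a in v_deg.
    by rewrite v_b deg_b in v_deg.
  have [p p_in pv] := succ_onto v_m; have hook_v := hook_leg v_m.
  exists p, (hook v); split=> //.
  - by rewrite -{1}pv !inE eqxx orbT.
  - by apply: contraNneq (hook_succ_notin p_in); rewrite pv => ->.
  - by rewrite e_sym -pv edge_succ.
  - by move: hook_v; rewrite in_legs => /andP[].
exists u, (tip u v); have [_ tip_u] := nbhd_leg us v_leg; split=> //.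
- move: us v_leg; rewrite in_spine => /orP[//|/eqP->].
  by rewrite legs_b inE.
- by rewrite !in_setU1 imset_f ?orbT.
- by move: v_leg; rewrite in_legs e_sym => /andP[].
- exact: leg_tip.
Qed.

(** Only the block of [c0], put first, can have more than 16 elements. Taking
    [c0 = a] covers the case without a vertex of large degree. *)
Lemma nbhd_prime_of_one_large (c0 : T) : c0 \in a :: m ->
    (forall c, c \in m -> c != c0 -> deg e c <= 16) ->
  nbhd_prime e.
Proof.
move=> c0_in small; pose cs := rem c0 (a :: m).
have cs_perm : perm_eq (a :: m) (c0 :: cs) := perm_to_rem c0_in.
have mem_cs := perm_mem cs_perm.
have init_uniq : uniq (a :: m).
  by have := s_uniq; rewrite /spine -rcons_cons rcons_uniq => /andP[].
have cs_uniq : uniq (c0 :: cs) by rewrite -(perm_uniq cs_perm).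
apply: (@nbhd_prime_of_blocks T e block c0 cs) => //.
- by move=> c _; rewrite !inE eqxx.
- by move=> c d; rewrite -!mem_cs; apply: block_disjoint.
- move=> c c_cs; have c_c0 : c != c0.
    by apply: contraTneq c_cs => ->; case/andP: cs_uniq.
  have : c \in a :: m by rewrite mem_cs in_cons c_cs orbT.
  rewrite inE => /orP[/eqP->|c_m].
    by apply: leq_trans (card_block a) _; rewrite legs_a cards0.
  by apply: leq_trans (card_block c) _; rewrite card_legs // small.
- by move=> v /block_nbhd[c [x [c_in ? ? ? ?]]]; exists c, x; rewrite -mem_cs.
Qed.

End Blocks.

End ReducedLobster.

Theorem proposition41 (T : finType) (e : rel T) (a : T) (m : seq T) (b : T)
  (hL : is_reduced_lobster e a m b)
  (hdeg : (forall v : T, v \in m -> 3 <= deg e v <= 16) \/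
          (exists v' : T, [/\ v' \in m, 16 < deg e v' &
             forall v : T, v \in m -> v <> v' -> 3 <= deg e v <= 16])) :
  nbhd_prime e.
Proof.
case: hdeg => [small | [v' [v'_m v'_deg small]]].
  apply: (nbhd_prime_of_one_large hL _ (mem_head a m)) => c c_m.
    by case/andP: (small c c_m).
  by case/andP: (small c c_m).
apply: (nbhd_prime_of_one_large hL _ (c0 := v')).
- move=> c c_m; have [->|/eqP c_v'] := eqVneq c v'; first by lia.
  by case/andP: (small c c_m c_v').
- by rewrite inE v'_m orbT.
by move=> c c_m /eqP c_v'; case/andP: (small c c_m c_v').
Qed.
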